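(* For all integers $n\ge 0$ and $r$, $s$, $t$, $k$, the following equalities hold, where $m\ge0$ denotes the integer with $n=2m$ or $n=2m+1$: \begin{align*} S_{n}^{(s,s+t)}(V)&=\lambda_{n}+a_{n+1}V_{s-r}V_{2n+r+s+t},\quad\text{with }\lambda_{n}=-q^{r-s}\Delta S_{n}^{(r,r+t)}(U),\\ A_{n}^{(2k,2k)}(V)&=\begin{cases}d_{m}V_{2k+2m}^{2}-2p^{2}\Delta b_{m-1}&\text{if }n=2m,\\ p^{2}\Delta c_{m}\left(1-a_{k+m+1}V_{2k+2m}\right)&\text{if }n=2m+1,\end{cases}\\ A_{n}^{(2k+1,2k+1)}(V)&=\begin{cases}-\Delta U_{2m+1}^{2}+d_{m}V_{2k+2m}V_{2k+2m+2}&\text{if }n=2m,\\ -p^{2}\Delta c_{m}a_{k+m+1}V_{2k+2m+2}&\text{if }n=2m+1,\end{cases}\\ A_{n}^{(2k,2k+1)}(V)&=\begin{cases}d_{m}V_{2k+2m}V_{2k+2m+1}-e_{m}&\text{if }n=2m,\\ -p\Delta c_{m}\left(U_{2k+2m+3}V_{2k+2m}-p^{2}+q\right)&\text{if }n=2m+1.\end{cases} \end{align*}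
   Context: Let $p,q$ be integers with $p\neq 0$, $q\in\{1,-1\}$, and $\Delta:=p^2-4q\neq 0$. The sequences $(U_n)_{n\in\mathbb{Z}}$ and $(V_n)_{n\in\mathbb{Z}}$ are defined by $U_0=0$, $U_1=1$, $V_0=2$, $V_1=p$ and the recurrences $U_n=pU_{n-1}-qU_{n-2}$, $V_n=pV_{n-1}-qV_{n-2}$ for all $n\in\mathbb{Z}$ (so they are extended to negative indices by the recurrence). Under these assumptions $U_2$, $V_2$ and $U_4$ are nonzero. For $n\in\mathbb{Z}$ define $$a_n=\frac{U_{2n}}{U_2},\quad d_n=\frac{V_{4n+2}}{V_2},\quad b_n=\frac{d_{n+1}-1}{p^2\Delta},\quad c_n=\frac{U_{4n+4}}{U_4},\quad e_n=p(d_n-1).$$ For a sequence $X=(X_m)_{m\in\mathbb{Z}}$, integers $r,s$ and $n\ge0$, set $S_n^{(r,s)}(X)=\sum_{i=0}^{n}X_{r+2i}X_{s+2i}$ and $A_n^{(r,s)}(X)=\sum_{i=0}^{n}(-1)^iX_{r+2i}X_{s+2i}$. *)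

(* Defs.v *)
From mathcomp Require Import all_boot all_order all_algebra.
From mathcomp Require Import zify ring.

Set Implicit Arguments.
Unset Strict Implicit.
Unset Printing Implicit Defensive.

Import Order.TTheory GRing.Theory Num.Theory.
Local Open Scope ring_scope.

Definition discr (p q : int) : int := p ^+ 2 - 4 * q.

(* Bi-infinite sequence with initial values x0, x1. For q = 1 or q = -1 it
   exists and is unique: the recurrence at n + 2 reads X n = q * (p * X (n + 1)
   - X (n + 2)), which gives the negative indices. *)
Definition lucas_seq (p q x0 x1 : int) (X : int -> int) : Prop :=
  [/\ X 0 = x0, X 1 = x1 &
      forall n : int, X n = p * X (n - 1) - q * X (n - 2)].

Definition lucasU (p q : int) (U : int -> int) : Prop := lucas_seq p q 0 1 U.
Definition lucasV (p q : int) (V : int -> int) : Prop := lucas_seq p q 2 p V.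

(* Exact quotients in rat, since integer division on int would round. *)
Definition lucas_a (U : int -> int) (n : int) : rat :=
  (U (2 * n))%:Q / (U 2)%:Q.

Definition lucas_d (V : int -> int) (n : int) : rat :=
  (V (4 * n + 2))%:Q / (V 2)%:Q.

Definition lucas_b (p q : int) (V : int -> int) (n : int) : rat :=
  (lucas_d V (n + 1) - 1) / (p%:Q ^+ 2 * (discr p q)%:Q).

Definition lucas_c (U : int -> int) (n : int) : rat :=
  (U (4 * n + 4))%:Q / (U 4)%:Q.

Definition lucas_e (p : int) (V : int -> int) (n : int) : rat :=
  p%:Q * (lucas_d V n - 1).

Definition sumS (X : int -> int) (n : nat) (r s : int) : int :=
  \sum_(0 <= i < n.+1) X (r + 2 * i%:Z) * X (s + 2 * i%:Z).

Definition sumA (X : int -> int) (n : nat) (r s : int) : int :=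
  \sum_(0 <= i < n.+1) (-1) ^+ i * X (r + 2 * i%:Z) * X (s + 2 * i%:Z).

Lemma lucas_seq_exists (p q x0 x1 : int) :
  q = 1 \/ q = -1 -> exists X, lucas_seq p q x0 x1 X.
Proof.
move=> hq; have qq : q * q = 1 by case: hq => ->.
pose fw n := iter n (fun z : int * int => (z.2, p * z.2 - q * z.1)) (x0, x1).
pose bw n := iter n (fun z : int * int => (q * (p * z.1 - z.2), z.1)) (x0, x1).
exists (fun n => match n with Posz k => (fw k).1 | Negz k => (bw k.+1).1 end).
split=> // -[[|[|k]]|k].
- have -> : (0 : int) - 1 = Negz 0 by [].
  have -> : (0 : int) - 2 = Negz 1 by [].
  rewrite /=; set y := p * x0 - x1.
  by rewrite !mulrBr !mulrA qq !mul1r; ring.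
- have -> : (1 : int) - 1 = 0 by [].
  have -> : (1 : int) - 2 = Negz 0 by [].
  by rewrite /= !mulrA qq mul1r; ring.
- have -> : (k.+2 : int) - 1 = k.+1 by lia.
  by have -> : (k.+2 : int) - 2 = k by lia.
- have -> : Negz k - 1 = Negz k.+1 by lia.
  have -> : Negz k - 2 = Negz k.+2 by lia.
  rewrite /=; set z := bw k; set y := q * (p * z.1 - z.2).
  by rewrite !mulrA qq mul1r; ring.
Qed.

(* Main.v *)
Require Import Defs.
From mathcomp Require Import all_boot all_order all_algebra.
From mathcomp Require Import zify ring.
Import GRing.Theory Num.Theory.
Local Open Scope ring_scope.

(** Every product of two terms of [U] and [V] is a combination of two terms
    whose indices are the sum and the difference of the given indices
    ([mul_lucasV], [mul_lucasU]).  These formulas hold because both sides are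
    solutions of the same second-order recurrence, in both directions since [q]
    is a unit, with the same two initial values ([lucas_seq_unique]).

    They turn the sums of products into sums of [V (x + 4 * i)] plus a constant
    times the number of terms, counted with signs.  The sum of [V (x + 4 * i)]
    telescopes once it is multiplied by [U 2] ([lucas_sum]), and the alternating
    one once it is multiplied by [V 2] ([lucas_alt_sum]).  Hence the
    denominators: [U 2] in [lucas_a], [V 2] in [lucas_d], both in [lucas_c].
    The two boundary terms that remain are again the two terms of a product
    formula, so they fold back into one product: [U] times [V] for the plain sum
    ([sumS_combination]), [V] times [V] or [U] times [U] for the alternating
    sum, according to the parity of the last index ([sumA_even], [sumA_odd]).

    In the plain sums the constants do not vanish, and they are removed by
    combining the sum for [V] with the one for [U], where they have the opposite
    sign; in the alternating sums they cancel in pairs, up to one copy when the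
    number of terms is odd. *)

Set Implicit Arguments.
Unset Strict Implicit.
Unset Printing Implicit Defensive.

(** * Integer sequences with a Lucas recurrence *)

Lemma lucas_seq_unique (p q x0 x1 : int) (X Y : int -> int) :
  q = 1 \/ q = -1 -> lucas_seq p q x0 x1 X -> lucas_seq p q x0 x1 Y -> X =1 Y.
Proof.
move=> hq [X0 X1 XS] [Y0 Y1 YS].
have up j : X j%:Z = Y j%:Z /\ X (j%:Z + 1) = Y (j%:Z + 1).
  elim: j => [|j [IH0 IH1]]; first by rewrite add0r X0 X1 Y0 Y1.
  rewrite (_ : j.+1%:Z = j%:Z + 1); last lia.
  split=> //; rewrite XS YS.
  rewrite (_ : j%:Z + 1 + 1 - 1 = j%:Z + 1); last lia.
  rewrite (_ : j%:Z + 1 + 1 - 2 = j%:Z); last lia.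
  by rewrite IH0 IH1.
have down j : X (- j%:Z) = Y (- j%:Z) /\ X (1 - j%:Z) = Y (1 - j%:Z).
  elim: j => [|j [IH0 IH1]]; first by rewrite oppr0 subr0 X0 X1 Y0 Y1.
  rewrite (_ : 1 - j.+1%:Z = - j%:Z); last lia.
  split=> //; move: (XS (1 - j%:Z)) (YS (1 - j%:Z)).
  rewrite (_ : 1 - j%:Z - 1 = - j%:Z); last lia.
  rewrite (_ : 1 - j%:Z - 2 = - j.+1%:Z); last lia.
  by rewrite IH0 IH1; case: hq => -> ; lia.
by case=> j; [case: (up j) | rewrite NegzE; case: (down j.+1)].
Qed.

(** * Products as sums of terms with shifted indices *)

Section ProductFormulas.

Variables (p q : int) (U V : int -> int).
Hypotheses (hq : q = 1 \/ q = -1) (hU : lucasU p q U) (hV : lucasV p q V).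

Definition lucas_rec (X : int -> int) : Prop :=
  forall n, X n = p * X (n - 1) - q * X (n - 2).

Lemma unit_q : q \is a GRing.unit.
Proof. by case: hq => ->. Qed.

(** Since [q = 1] or [q = -1], only the parity of an exponent of [q] matters;
    hence [q ^ b] drops out of a product formula with an even shift [b]. *)
Lemma expq_even (z : int) : q ^ (2 * z) = 1.
Proof.
by rewrite -exprz_exp; case: hq => ->; rewrite (_ : _ ^ 2 = 1) ?exp1rz.
Qed.

Lemma expq_parity (x y z : int) : x = y + 2 * z -> q ^ x = q ^ y.
Proof. by move=> ->; rewrite exprzDr ?unit_q // expq_even mulr1. Qed.

Lemma lucas_rec_shift X (a : int) :
  lucas_rec X -> lucas_rec (fun b => X (a + b)).
Proof. by move=> XS b; rewrite XS !addrA. Qed.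

(** Read backwards, the recurrence is [X n = p / q * X (n + 1) - X (n + 2) / q],
    with [1 / q] where a coefficient [q] is wanted; multiplying the term at [b]
    by [q ^ b] turns these coefficients into [p] and [q].  Such reflected terms
    are the second summands of the product formulas below. *)
Lemma lucas_rec_reflect X (a : int) :
  lucas_rec X -> lucas_rec (fun b => q ^ b * X (a - b)).
Proof.
move=> XS b.
have := XS (a - (b - 2)).
rewrite (_ : a - (b - 2) - 1 = a - (b - 1)); last ring.
rewrite (_ : a - (b - 2) - 2 = a - b); last ring.
move=> ->.
rewrite (_ : q ^ (b - 2) = q ^ b); last by apply: (@expq_parity _ _ (-1)).
have -> : q ^ (b - 1) = q ^ b * q.
  by rewrite -(@expq_parity (b + 1) _ 1) ?exprzDr ?unit_q //; ring.
by case: hq => ->; ring.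
Qed.

(** As functions of [b], both sides satisfy the recurrence, so it suffices to
    compare them at [b = 0] and [b = 1].  In terms of the roots [alpha], [beta]
    of the characteristic polynomial, where [alpha * beta = q], this is the
    expansion of a product with [V b = alpha ^ b + beta ^ b]; the argument by
    initial values stays inside the integers. *)
Lemma mul_lucasV X a b : lucas_rec X ->
  X a * V b = X (a + b) + q ^ b * X (a - b).
Proof.
move=> XS; have [V0 V1 VS] := hV.
apply: (@lucas_seq_unique p q (2 * X a) (p * X a)
  (fun b => X a * V b) (fun b => X (a + b) + q ^ b * X (a - b))) => //.
  by split=> [||n]; rewrite ?V0 ?V1 ?(VS n); ring.
split=> [||n].
- by rewrite addr0 expr0z; ring.
- rewrite expr1z (XS (a + 1)).
  by rewrite (_ : a + 1 - 1 = a) 1?(_ : a + 1 - 2 = a - 1); ring.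
- by rewrite {1}(lucas_rec_shift a XS n) {1}(lucas_rec_reflect a XS n); ring.
Qed.

(** The companion of [mul_lucasV], with the same proof, for
    [(alpha - beta) * U b = alpha ^ b - beta ^ b].
    The factor [X (a + 1) - q * X (a - 1)] is the value of the right-hand side
    at [b = 1]; it is [V a] for [X = U] and [discr p q * U a] for [X = V]. *)
Lemma mul_lucasU X a b : lucas_rec X ->
  (X (a + 1) - q * X (a - 1)) * U b = X (a + b) - q ^ b * X (a - b).
Proof.
move=> XS; have [U0 U1 US] := hU.
apply: (@lucas_seq_unique p q 0 (X (a + 1) - q * X (a - 1))
  (fun b => (X (a + 1) - q * X (a - 1)) * U b)
  (fun b => X (a + b) - q ^ b * X (a - b))) => //.
  by split=> [||n]; rewrite ?U0 ?U1 ?(US n); ring.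
split=> [||n].
- by rewrite addr0 expr0z; ring.
- by rewrite expr1z.
- by rewrite {1}(lucas_rec_shift a XS n) {1}(lucas_rec_reflect a XS n); ring.
Qed.

Lemma lucas_recU : lucas_rec U. Proof. by have [] := hU. Qed.
Lemma lucas_recV : lucas_rec V. Proof. by have [] := hV. Qed.

Lemma lucas_rec_conj X :
  lucas_rec X -> lucas_rec (fun a => X (a + 1) - q * X (a - 1)).
Proof.
move=> XS a; rewrite (XS (a + 1)) (XS (a - 1)).
by rewrite ![a + 1 - _]addrAC [a - 1 - 2]addrAC; ring.
Qed.

Lemma lucasU2 : U 2 = p.
Proof. by have [U0 U1 ->] := hU; rewrite U0 U1; ring. Qed.

Lemma lucasV2 : V 2 = p ^+ 2 - 2 * q.
Proof. by have [V0 V1 ->] := hV; rewrite V0 V1; ring. Qed.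

Lemma conj_lucasU a : U (a + 1) - q * U (a - 1) = V a.
Proof.
have [U0 U1 _] := hU; have [V0 V1 VS] := hV.
apply: (@lucas_seq_unique p q 2 p (fun a => U (a + 1) - q * U (a - 1)) V) => //.
split; last exact: lucas_rec_conj lucas_recU.
- have := lucas_recU 1 : U 1 = p * U 0 - q * U (-1).
  by rewrite add0r sub0r U0 U1; move: (q * _) => z; lia.
- by rewrite subrr U0 mulr0 subr0; exact: lucasU2.
Qed.

Lemma conj_lucasV a : V (a + 1) - q * V (a - 1) = discr p q * U a.
Proof.
have [V0 V1 _] := hV; have [U0 U1 US] := hU.
apply: (@lucas_seq_unique p q 0 (discr p q)
  (fun a => V (a + 1) - q * V (a - 1)) (fun a => discr p q * U a)) => //.
  split; last exact: lucas_rec_conj lucas_recV.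
  - have := lucas_recV 1 : V 1 = p * V 0 - q * V (-1).
    by rewrite add0r sub0r V0 V1; move: (q * _) => z; lia.
  - by rewrite subrr V0 (lucasV2 : V (1 + 1) = _) /discr; ring.
by split=> [||n]; rewrite ?U0 ?U1 ?(US n); ring.
Qed.

Lemma lucasUV_even a z : U (a + 2 * z) * V (2 * z) = U (a + 4 * z) + U a.
Proof.
rewrite (mul_lucasV _ _ lucas_recU) expq_even mul1r.
by congr (U _ + U _); ring.
Qed.

Lemma lucasVV a t : V a * V (a + t) = V (2 * a + t) + q ^ a * V t.
Proof.
rewrite mulrC (mul_lucasV _ _ lucas_recV) -addrAC.
by congr (V _ + _ * V _); ring.
Qed.

Lemma lucasUU a t :
  discr p q * (U a * U (a + t)) = V (2 * a + t) - q ^ a * V t.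
Proof.
rewrite [U a * _]mulrC mulrA -conj_lucasV (mul_lucasU _ _ lucas_recV).
by congr (V _ - _ * V _); ring.
Qed.

(** * Telescoping sums along a progression of step 4 *)

(** Multiplication by [p = U 2] turns the sum into a telescoping one, because
    [p * V y = U (y + 2) - U (y - 2)]. *)
Lemma lucas_sum (x : int) (n : nat) :
  p * \sum_(0 <= i < n.+1) V (x + 4 * i%:Z) =
  U (2 * n%:Z + 2) * V (2 * n%:Z + x).
Proof.
rewrite [RHS]mulrC -(conj_lucasU (2 * n%:Z + x)).
rewrite (mul_lucasU _ _ lucas_recU) (_ : 2 * n%:Z + 2 = 2 * (n%:Z + 1)); last ring.
rewrite expq_even mul1r (_ : 2 * n%:Z + x - 2 * (n%:Z + 1) = x - 2); last ring.
have step y : p * V y = U (y + 2) - U (y - 2).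
  rewrite -lucasU2 mulrC -conj_lucasU (mul_lucasU _ _ lucas_recU).
  by rewrite (expq_even 1) mul1r.
elim: n => [|n IHn].
  by rewrite big_nat1 step !mulr0 !addr0 !add0r mulr1 (addrC x).
rewrite big_nat_recr //= mulrDr IHn step.
rewrite (_ : x + 4 * n.+1%:Z - 2 = 2 * n%:Z + x + 2 * (n%:Z + 1)); last by lia.
rewrite (_ : x + 4 * n.+1%:Z + 2 = 2 * n.+1%:Z + x + 2 * (n.+1%:Z + 1)).
  by ring.
by lia.
Qed.

(** Here the alternating sum telescopes after multiplication by [V 2], because
    [V 2 * V y = V (y + 2) + V (y - 2)]. *)
Lemma lucas_alt_sum (x : int) (n : nat) :
  V 2 * \sum_(0 <= i < n.+1) (-1) ^+ i * V (x + 4 * i%:Z) =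
  V (x - 2) + (-1) ^+ n * V (x + 4 * n%:Z + 2).
Proof.
have step y : V 2 * V y = V (y + 2) + V (y - 2).
  by rewrite mulrC (mul_lucasV _ _ lucas_recV) (expq_even 1) mul1r.
elim: n => [|n IHn].
  by rewrite big_nat1 expr0 !mul1r step mulr0 addr0 addrC.
rewrite big_nat_recr //= mulrDr IHn mulrCA step exprS.
rewrite (_ : x + 4 * n.+1%:Z - 2 = x + 4 * n%:Z + 2); last by lia.
by ring.
Qed.

Lemma sum_sign (n : nat) :
  \sum_(0 <= i < n.+1) (-1) ^+ i = (~~ odd n)%:R :> int.
Proof.
elim: n => [|n IHn]; first by rewrite big_nat1.
by rewrite big_nat_recr //= IHn -signr_odd /=; case: (odd n).
Qed.

(** * Sums of products *)

(** By [lucasVV] the summands are alternating terms [V (x + 4 * i)] plus an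
    alternating constant, and the latter sums to 0 or 1 times itself. *)
Lemma sumA_linear (n : nat) (a t : int) :
  V 2 * sumA V n a (a + t) =
  V (2 * a + t - 2) + (-1) ^+ n * V (2 * a + t + 4 * n%:Z + 2)
  + (~~ odd n)%:R * (q ^ a * V t * V 2).
Proof.
rewrite -lucas_alt_sum -sum_sign /sumA [in RHS]mulr_suml mulr_sumr.
rewrite mulr_sumr -big_split /=; apply: eq_bigr => i _.
rewrite -mulrA addrAC lucasVV (@expq_parity (a + 2 * i%:Z) a i%:Z) //.
rewrite (_ : 2 * (a + 2 * i%:Z) + t = 2 * a + t + 4 * i%:Z); last ring.
by ring.
Qed.

(** For an even number [n = 2 * m] the two boundary terms of the telescoped sum
    are added, and so recombine into a product of two values of [V]; for
    [n = 2 * m + 1] they are subtracted, and recombine into a product of two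
    values of [U]. *)
Lemma sumA_even (m : nat) (a t : int) :
  V 2 * sumA V (2 * m) a (a + t) =
  V (4 * m%:Z + 2) * V (2 * a + t + 4 * m%:Z) + q ^ a * V t * V 2.
Proof.
rewrite sumA_linear oddM /= mul1r exprM sqrrN !expr1n mul1r.
rewrite [V (4 * _ + 2) * _]mulrC (mul_lucasV _ _ lucas_recV).
rewrite (_ : 4 * m%:Z + 2 = 2 * (2 * m%:Z + 1)); last ring.
rewrite expq_even mul1r.
rewrite [V (2 * a + t - 2) + _]addrC.
by congr (V _ + V _ + _); lia.
Qed.

Lemma sumA_odd (m : nat) (a t : int) :
  V 2 * sumA V (2 * m + 1) a (a + t) =
  - discr p q * U (4 * m%:Z + 4) * U (2 * a + t + 4 * m%:Z + 2).
Proof.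
rewrite sumA_linear oddD oddM /= mul0r addr0 exprD exprM sqrrN !expr1n mul1r.
rewrite !mulNr mul1r mulrAC -conj_lucasV (mul_lucasU _ _ lucas_recV).
rewrite (_ : 4 * m%:Z + 4 = 2 * (2 * m%:Z + 2)); last ring.
rewrite expq_even mul1r opprB.
by congr (V _ - V _); lia.
Qed.

(** The non-alternating constants [q ^ s * V t] would contribute a multiple of
    [n + 1].  They have opposite signs in [lucasVV] and [lucasUU], and the
    weight [q ^ (r - s)] makes them cancel; what is left of the two summands is
    [V (r + s + t + 4 * i) * V (s - r)], whose second factor is constant. *)
Lemma sumS_combination (n : nat) (r s t : int) :
  p * (sumS V n s (s + t) + q ^ (r - s) * discr p q * sumS U n r (r + t)) =
  U (2 * n%:Z + 2) * V (s - r) * V (2 * n%:Z + r + s + t).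
Proof.
rewrite [RHS]mulrAC (_ : 2 * n%:Z + r + s + t = 2 * n%:Z + (r + s + t)); last ring.
rewrite -lucas_sum /sumS -[RHS]mulrA; congr (p * _).
rewrite mulr_sumr mulr_suml -big_split /=; apply: eq_bigr => i _.
rewrite -[q ^ _ * _ * _]mulrA addrAC lucasVV [r + t + _]addrAC lucasUU.
rewrite (mul_lucasV _ _ lucas_recV).
rewrite (@expq_parity (s - r) (r - s) (s - r)); last ring.
rewrite (@expq_parity (s + 2 * i%:Z) s i%:Z) //.
rewrite (@expq_parity (r + 2 * i%:Z) r i%:Z) //.
have -> : q ^ s = q ^ (r - s) * q ^ r.
  by rewrite -exprzDr ?unit_q //; apply: (@expq_parity _ _ (s - r)); ring.
rewrite (_ : r + s + t + 4 * i%:Z + (s - r) = 2 * (s + 2 * i%:Z) + t); last ring.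
rewrite (_ : r + s + t + 4 * i%:Z - (s - r) = 2 * (r + 2 * i%:Z) + t); last ring.
by ring.
Qed.

End ProductFormulas.

(** * The four closed forms *)

(** It remains to clear the denominators [U 2 = p] and [V 2] (with
    [U 4 = p * V 2]).  In [sumA_even] and [sumA_odd] the factor whose index
    depends on [k] is unfolded by [lucasVV] or [lucasUV_even] into a product of
    two terms of about half the index; this brings in the lower-order
    corrections of the alternating formulas. *)
Theorem theorem7 (p q : int) (U V : int -> int)
  (hp : p != 0) (hq : q = 1 \/ q = -1) (hD : discr p q != 0)
  (hU : lucasU p q U) (hV : lucasV p q V)
  (n m : nat) (hm : n = (2 * m)%N \/ n = (2 * m + 1)%N) (r s t k : int) :
  [/\ (sumS V n s (s + t))%:Q =
        - q%:Q ^ (r - s) * (discr p q)%:Q * (sumS U n r (r + t))%:Q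
        + lucas_a U (n%:Z + 1) * (V (s - r))%:Q
          * (V (2 * n%:Z + r + s + t))%:Q,
      (sumA V n (2 * k) (2 * k))%:Q =
        (if n == (2 * m)%N then
           lucas_d V m%:Z * (V (2 * k + 2 * m%:Z))%:Q ^+ 2
           - 2 * p%:Q ^+ 2 * (discr p q)%:Q * lucas_b p q V (m%:Z - 1)
         else
           p%:Q ^+ 2 * (discr p q)%:Q * lucas_c U m%:Z
           * (1 - lucas_a U (k + m%:Z + 1) * (V (2 * k + 2 * m%:Z))%:Q)),
      (sumA V n (2 * k + 1) (2 * k + 1))%:Q =
        (if n == (2 * m)%N then
           - (discr p q)%:Q * (U (2 * m%:Z + 1))%:Q ^+ 2
           + lucas_d V m%:Z * (V (2 * k + 2 * m%:Z))%:Q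
             * (V (2 * k + 2 * m%:Z + 2))%:Q
         else
           - p%:Q ^+ 2 * (discr p q)%:Q * lucas_c U m%:Z
           * lucas_a U (k + m%:Z + 1) * (V (2 * k + 2 * m%:Z + 2))%:Q)
    & (sumA V n (2 * k) (2 * k + 1))%:Q =
        (if n == (2 * m)%N then
           lucas_d V m%:Z * (V (2 * k + 2 * m%:Z))%:Q
             * (V (2 * k + 2 * m%:Z + 1))%:Q
           - lucas_e p V m%:Z
         else
           - p%:Q * (discr p q)%:Q * lucas_c U m%:Z
           * ((U (2 * k + 2 * m%:Z + 3))%:Q * (V (2 * k + 2 * m%:Z))%:Q
              - p%:Q ^+ 2 + q%:Q))].
Proof.
have V2neq0 : (V 2)%:Q != 0.
  rewrite intr_eq0 (lucasV2 hV).
  (* [p ^ 2 = 2 * q] is impossible: [p ^ 2] is 0, 1 or at least 4. *)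
  have : p <= -2 \/ p = -1 \/ p = 0 \/ p = 1 \/ 2 <= p by lia.
  by case: hq => ->; rewrite expr2; nia.
have pneq0 : p%:Q != 0 by rewrite intr_eq0.
have Dneq0 : (discr p q)%:Q != 0 by rewrite intr_eq0.
have U0 : U 0 = 0 by have [] := hU.
have U2 : U 2 = p := lucasU2 hU.
have U3 : U 3 = p ^+ 2 - q by have [_ U1 ->] := hU; rewrite U1 U2; ring.
have U4 : U 4 = p * V 2.
  have := lucasUV_even hq hU hV 0 1.
  by rewrite !mulr1 !add0r U0 addr0 U2 => ->.
have V0 : V 0 = 2 by have [] := hV.
have V1 : V 1 = p by have [] := hV.
split.
- apply: (mulfI pneq0).
  have := congr1 (fun z : int => z%:Q) (sumS_combination hq hU hV n r s t).
  rewrite /lucas_a U2 (_ : 2 * (n%:Z + 1) = 2 * n%:Z + 2); last ring.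
  have -> : q%:Q ^ (r - s) = (q ^ (r - s))%:Q by rewrite rmorphXz // (unit_q hq).
  rewrite !intrM intrD !intrM => E.
  apply/eqP; rewrite -subr_eq0; apply/eqP.
  transitivity (p%:Q * ((sumS V n s (s + t))%:Q
      + (q ^ (r - s))%:Q * (discr p q)%:Q * (sumS U n r (r + t))%:Q)
    - (U (2 * n%:Z + 2))%:Q * (V (s - r))%:Q
      * (V (2 * n%:Z + r + s + t))%:Q); first by field.
  by rewrite E subrr.
- apply: (mulfI V2neq0); rewrite -intrM -[X in sumA V n _ X]addr0.
  case: hm => ->.
    rewrite eqxx (sumA_even hq hV) (expq_even hq) V0 mul1r addr0.
    have -> : V (2 * (2 * k) + 4 * m%:Z) = V (2 * k + 2 * m%:Z) ^+ 2 - 2.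
      rewrite expr2 -[X in _ * V X]addr0 (lucasVV hq hV) -mulrDr (expq_even hq).
      by rewrite V0 mul1r addrK; congr V; ring.
    rewrite /lucas_b /lucas_d subrK.
    by field; rewrite Dneq0 pneq0 V2neq0.
  rewrite (_ : (_ == _) = false); last by lia.
  rewrite (sumA_odd hq hU hV).
  rewrite (_ : 2 * (2 * k) + 0 + 4 * m%:Z + 2 = 2 + 4 * (k + m%:Z)); last ring.
  have -> : U (2 + 4 * (k + m%:Z)) = U (2 * (k + m%:Z + 1)) * V (2 * k + 2 * m%:Z) - p.
    rewrite -U2 -[LHS](addrK (U 2)) -(lucasUV_even hq hU hV).
    by congr (U _ * V _ - _); ring.
  rewrite /lucas_c /lucas_a U2 U4.
  by field; rewrite V2neq0 pneq0.
- apply: (mulfI V2neq0); rewrite -intrM -[X in sumA V n _ X]addr0.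
  case: hm => ->.
    rewrite eqxx (sumA_even hq hV) V0 addr0.
    have -> : q ^ (2 * k + 1) = q.
      by rewrite (@expq_parity _ hq _ 1 k) ?expr1z // addrC.
    have -> : V (2 * (2 * k + 1) + 4 * m%:Z)
        = V (2 * k + 2 * m%:Z) * V (2 * k + 2 * m%:Z + 2) - V 2.
      rewrite (lucasVV hq hV) -mulrDr (expq_even hq) mul1r addrK.
      by congr V; ring.
    have UU : discr p q * U (2 * m%:Z + 1) ^+ 2 = V (4 * m%:Z + 2) - q * 2.
      rewrite expr2 -[X in _ * U X]addr0 (lucasUU hq hU hV) V0.
      rewrite (@expq_parity _ hq _ 1 m) ?expr1z; last ring.
      by congr (V _ - _); ring.
    rewrite mulNr -rmorphXn -intrM UU /lucas_d.
    by field.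
  rewrite (_ : (_ == _) = false); last by lia.
  rewrite (sumA_odd hq hU hV).
  rewrite (_ : 2 * (2 * k + 1) + 0 + 4 * m%:Z + 2 = 0 + 4 * (k + m%:Z + 1)); last ring.
  have -> : U (0 + 4 * (k + m%:Z + 1)) =
      U (2 * (k + m%:Z + 1)) * V (2 * k + 2 * m%:Z + 2).
    rewrite -[LHS](addrK (U 0)) -(lucasUV_even hq hU hV) add0r U0 subr0.
    by congr (U _ * V _); ring.
  rewrite /lucas_c /lucas_a U2 U4.
  by field; rewrite V2neq0 pneq0.
- apply: (mulfI V2neq0); rewrite -intrM.
  case: hm => ->.
    rewrite eqxx (sumA_even hq hV) (expq_even hq) V1 mul1r.
    have -> : V (2 * (2 * k) + 1 + 4 * m%:Z)
        = V (2 * k + 2 * m%:Z) * V (2 * k + 2 * m%:Z + 1) - p.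
      rewrite (lucasVV hq hV) -mulrDr (expq_even hq) mul1r V1 addrK.
      by congr V; ring.
    rewrite /lucas_e /lucas_d.
    by field.
  rewrite (_ : (_ == _) = false); last by lia.
  rewrite (sumA_odd hq hU hV).
  rewrite (_ : 2 * (2 * k) + 1 + 4 * m%:Z + 2 = 3 + 4 * (k + m%:Z)); last ring.
  have -> : U (3 + 4 * (k + m%:Z)) =
      U (2 * k + 2 * m%:Z + 3) * V (2 * k + 2 * m%:Z) - (p ^+ 2 - q).
    rewrite -U3 -[LHS](addrK (U 3)) -(lucasUV_even hq hU hV).
    by congr (U _ * V _ - _); ring.
  rewrite /lucas_c U4.
  by field; rewrite V2neq0 pneq0.
Qed.
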